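(* Any block stationary point (BS-point) of the problem $\min_{X\in\mathbb{R}^{n\times n}} f(X)$ subject to $X^\top J X = J$ is a critical point of this problem, while the reverse is not necessarily true.
   Context: Let $J=\begin{pmatrix} I_p & 0\\ 0 & -I_{n-p}\end{pmatrix}\in\mathbb{R}^{n\times n}$ and $\mathcal{J}=\{X\in\mathbb{R}^{n\times n}: X^\top J X = J\}$. Consider $\min_{X\in\mathcal{J}} f(X)$ with $f(X)=\frac1N\sum_{i=1}^N f_i(X)$, each $f_i$ continuously differentiable and satisfying $f_i(X^+)\le f_i(X)+\langle X^+-X,\nabla f_i(X)\rangle+\frac12\|X^+-X\|_H^2$ for a symmetric positive semidefinite $H\in\mathbb{R}^{nn\times nn}$ with $\|H\|\le L_f$, where $\|X\|_H^2=\mathrm{vec}(X)^\top H\,\mathrm{vec}(X)$. Critical point: $\check X\in\mathcal{J}$ is a critical point if $0=\nabla f(\check X)-J\check X[\nabla f(\check X)]^\top \check X J$ (equivalently, the matrix $\check X\nabla f(\check X)^\top J$ is symmetric). Block stationary point: let $\Omega$ be the set of all index vectors $\mathcal{B}$ choosing 2 distinct items from $[n]$. For $\mathcal{B}\in\Omega$, let $U_{\mathcal{B}}\in\mathbb{R}^{n\times 2}$ with $(U_{\mathcal{B}})_{ji}=1$ if $\mathcal{B}_i=j$ and $0$ otherwise, $J_{\mathcal{B}\mathcal{B}}\in\mathbb{R}^{2\times2}$ the submatrix of $J$ indexed by $\mathcal{B}$, and $\mathcal{J}_{\mathcal{B}}=\{V\in\mathbb{R}^{2\times2}: V^\top J_{\mathcal{B}\mathcal{B}}V=J_{\mathcal{B}\mathcal{B}}\}$.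 Define $\mathcal{G}(V;X,\mathcal{B})=f(X)+\frac12\|V-I_2\|_{Q+\theta I}^2+\langle V-I_2,[\nabla f(X)X^\top]_{\mathcal{B}\mathcal{B}}\rangle$, where $\theta>0$ and $Q\in\mathbb{R}^{4\times4}$ is either $\underline{Q}=(Z^\top\otimes U_{\mathcal{B}})^\top H(Z^\top\otimes U_{\mathcal{B}})$ with $Z=U_{\mathcal{B}}^\top X$, or $Q=\varsigma I$ with $\|\underline{Q}\|\le\varsigma\le L_f$. A point $\ddot X\in\mathcal{J}$ is a block stationary point if for all $\mathcal{B}\in\Omega$, $I_2\in\arg\min_{V\in\mathcal{J}_{\mathcal{B}}}\mathcal{G}(V;\ddot X,\mathcal{B})$. *)

(* Defs.v *)
From mathcomp Require Import all_boot all_order all_algebra.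
From mathcomp Require Import all_classical all_reals all_analysis.
From mathcomp Require Export mxtens.

Set Implicit Arguments.
Unset Strict Implicit.
Unset Printing Implicit Defensive.

Import Order.TTheory GRing.Theory Num.Theory.
Import numFieldNormedType.Exports.

Local Open Scope classical_set_scope.
Local Open Scope ring_scope.

Section LinearAlgebra.
Variable R : realType.

(* The signature matrix diag(I_p, -I_(n-p)); it has this form for p <= n. *)
Definition sigJ (n p : nat) : 'M[R]_n :=
  diag_mx (\row_(i < n) (if (i < p)%N then 1 else -1)).

Definition Junitary (m : nat) (J : 'M[R]_m) : set 'M[R]_m :=
  [set V | V^T *m J *m V = J].

Definition inner (m n : nat) (A B : 'M[R]_(m, n)) : R := \tr (A^T *m B).

(* Column-stacking vectorization: the entry of rank j * m + i is X i j.  The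
   index pairing is the one of the Kronecker product tensmx, see vecM. *)
Definition vec (m n : nat) (X : 'M[R]_(m, n)) : 'cV[R]_(n * m) :=
  \col_k X (mxtens_unindex k).2 (mxtens_unindex k).1.

Lemma vecM (m n k l : nat)
    (A : 'M[R]_(k, m)) (X : 'M[R]_(m, n)) (B : 'M[R]_(n, l)) :
  vec (A *m X *m B) = tensmx B^T A *m vec X.
Proof.
apply/colP => r; rewrite !mxE.
under eq_bigr do rewrite mxE big_distrl /=.
rewrite pair_big (reindex (@mxtens_unindex n m)) /=; last first.
  by exists (@mxtens_index n m) => x _; rewrite (mxtens_indexK, mxtens_unindexK).
by apply: eq_bigr => q _; rewrite !mxE /= mulrC mulrA.
Qed.

(* ||X||_H ^ 2 *)
Definition sqnorm_mx (m n : nat) (H : 'M[R]_(n * m)) (X : 'M[R]_(m, n)) : R :=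
  ((vec X)^T *m H *m vec X) 0 0.

Definition psd (m : nat) (H : 'M[R]_m) : Prop :=
  H^T = H /\ forall x : 'cV[R]_m, 0 <= (x^T *m H *m x) 0 0.

Definition enorm (m : nat) (x : 'cV[R]_m) : R :=
  Num.sqrt (\sum_(i < m) x i 0 ^+ 2).

Definition spectral_norm (m n : nat) (A : 'M[R]_(m, n)) : R :=
  sup [set enorm (A *m x) | x in [set x : 'cV[R]_n | enorm x <= 1]].

Definition argmin (T : Type) (D : set T) (g : T -> R) : set T :=
  [set v | D v /\ forall w, D w -> g v <= g w].

(* Gradient for the inner product [inner]. *)
Definition grad (m n : nat) (f : 'M[R]_(m, n) -> R) (X : 'M[R]_(m, n)) :
    'M[R]_(m, n) :=
  \matrix_(i, j) 'D_(delta_mx i j) f X.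

Definition continuously_differentiable (m n : nat) (f : 'M[R]_(m, n) -> R) :
    Prop :=
  (forall X, differentiable f X) /\ continuous (grad f).

End LinearAlgebra.

Section Problem.
Variables (R : realType) (n : nat).

Definition objective (N : nat) (f : 'I_N -> 'M[R]_n -> R) (X : 'M[R]_n) : R :=
  N%:R^-1 * \sum_(i < N) f i X.

Definition objective_assumptions (N : nat) (f : 'I_N -> 'M[R]_n -> R)
    (H : 'M[R]_(n * n)) (Lf : R) : Prop :=
  [/\ psd H,
      spectral_norm H <= Lf,
      forall i, continuously_differentiable (f i) &
      forall i (X Y : 'M[R]_n),
        f i Y <= f i X + inner (Y - X) (grad (f i) X)
                 + 2^-1 * sqnorm_mx H (Y - X)].

Definition critical_point (p : nat) (f : 'M[R]_n -> R) (X : 'M[R]_n) : Prop :=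
  let J := sigJ R n p in
  Junitary J X /\ 0 = grad f X - J *m X *m (grad f X)^T *m X *m J.

(* Index vectors choosing two distinct items of [n]. *)
Definition Omega : set ('I_2 -> 'I_n) := [set B | injective B].

Definition selU (B : 'I_2 -> 'I_n) : 'M[R]_(n, 2) :=
  \matrix_(j < n, i < 2) (B i == j)%:R.

Definition Qlow (H : 'M[R]_(n * n)) (X : 'M[R]_n) (B : 'I_2 -> 'I_n) :
    'M[R]_(2 * 2) :=
  let Z := (selU B)^T *m X in
  (tensmx Z^T (selU B))^T *m H *m tensmx Z^T (selU B).

(* The two possible quadratic models Q of the block subproblem. *)
Variant Qmodel := Qexact | Qscalar.

(* The scalar may depend on the block. *)
Definition Qadmissible (k : Qmodel) (H : 'M[R]_(n * n)) (Lf : R) (X : 'M[R]_n)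
    (Q : ('I_2 -> 'I_n) -> 'M[R]_(2 * 2)) : Prop :=
  forall B, Omega B ->
    match k with
    | Qexact => Q B = Qlow H X B
    | Qscalar => exists s : R,
        spectral_norm (Qlow H X B) <= s <= Lf /\ Q B = s%:M
    end.

Definition block_model (f : 'M[R]_n -> R) (theta : R) (QB : 'M[R]_(2 * 2))
    (X : 'M[R]_n) (B : 'I_2 -> 'I_n) (V : 'M[R]_2) : R :=
  f X + 2^-1 * sqnorm_mx (QB + theta%:M) (V - 1%:M)
  + inner (V - 1%:M) (mxsub B B (grad f X *m X^T)).

Definition bs_point (p : nat) (f : 'M[R]_n -> R) (theta : R)
    (Q : ('I_2 -> 'I_n) -> 'M[R]_(2 * 2)) (X : 'M[R]_n) : Prop :=
  Junitary (sigJ R n p) X /\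
  forall B, Omega B ->
    argmin (Junitary (mxsub B B (sigJ R n p)))
           (block_model f theta (Q B) X B) 1%:M.

End Problem.

(* Main.v *)
(* Write e for the product of the two signs in J_BB.  The block
   [[c, s], [- e s, c]] with c = (1 - e t^2) / (1 + e t^2) and
   s = 2 t / (1 + e t^2) is a rotation (e = 1) or a boost (e = -1); it preserves
   J_BB and passes through the identity at t = 0.  Minimality of the block model
   at I along this curve, as t tends to 0 from both sides, makes the block of
   J (grad f X) X^T symmetric.  All blocks together make J (grad f X) X^T
   symmetric, and this gives criticality.
   For the converse take every f_i = 2 theta tr, with H = 0 and Q = 0: the
   identity is critical, but V = - I improves every block model by 4 theta. *)

From HB Require Import structures.
Require Import Defs.
From mathcomp Require Import all_boot all_order all_algebra.
From mathcomp Require Import all_classical all_reals all_analysis.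
From mathcomp Require Import lra.
Import Order.TTheory GRing.Theory Num.Theory.
Import numFieldNormedType.Exports.
Local Open Scope ring_scope.

Set Implicit Arguments.
Unset Strict Implicit.
Unset Printing Implicit Defensive.

(** * Quadratic forms, and the sign of a polynomial near zero *)

Lemma sqnorm_mxZ (R : realType) (m n : nat) (H : 'M[R]_(n * m)) (t : R)
    (A : 'M[R]_(m, n)) :
  sqnorm_mx H (t *: A) = t ^+ 2 * sqnorm_mx H A.
Proof.
have -> : sqnorm_mx H (t *: A) = ((t *: vec A)^T *m H *m (t *: vec A)) 0 0.
  by congr ((_^T *m _ *m _) 0 0); apply/colP => k; rewrite !mxE.
have -> : (t *: vec A)^T = t *: (vec A)^T by apply/rowP => k; rewrite !mxE.
by rewrite -!scalemxAl -scalemxAr scalerA mxE.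
Qed.

(** On the curve of blocks, [V - I] is a scalar times a matrix affine in [t], so the quadratic term
    of the model becomes explicit in [t]. *)
Lemma sqnorm_mx_affine (R : realType) (m n : nat) (H : 'M[R]_(n * m))
    (A B : 'M[R]_(m, n)) :
  exists c0 c1 c2 : R, forall t : R,
    sqnorm_mx H (A + t *: B) = c0 + t * c1 + t ^+ 2 * c2.
Proof.
pose q (x y : 'cV[R]_(n * m)) := (x^T *m H *m y) 0 0.
exists (q (vec A) (vec A)), (q (vec A) (vec B) + q (vec B) (vec A)),
  (q (vec B) (vec B)) => t.
have vecDZ : vec (A + t *: B) = vec A + t *: vec B.
  by apply/colP => k; rewrite !mxE.
have trDZ : (vec A + t *: vec B)^T = (vec A)^T + t *: (vec B)^T.
  by apply/rowP => k; rewrite !mxE.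
rewrite /sqnorm_mx /q vecDZ trDZ !mulmxDl !mulmxDr -!scalemxAl -!scalemxAr.
move: (_ *m vec A) (_ *m vec B) (_ *m _ *m vec A) (_ *m _ *m vec B).
by move=> q11 q12 q21 q22; rewrite !mxE; lra.
Qed.

Lemma sqnorm_scalar_mx (R : realType) (m n : nat) (a : R) (X : 'M[R]_(m, n)) :
  sqnorm_mx a%:M X = a * inner X X.
Proof.
rewrite /sqnorm_mx mul_mx_scalar -scalemxAl mxE; congr (_ * _).
rewrite mxE /inner /mxtrace; under [RHS]eq_bigr do rewrite mxE.
rewrite pair_big [RHS](reindex (@mxtens_unindex n m)) /=; last first.
  by exists (@mxtens_index n m) => x _; rewrite (mxtens_indexK, mxtens_unindexK).
by apply: eq_bigr => k _; rewrite !mxE.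
Qed.

(** If [b] were nonzero, the bracket would keep the sign of [b] for small [t], and a [t] of the
    opposite sign would make the product negative. *)
Lemma lin_coef_eq0 (R : realType) (b c0 c1 c2 : R) :
  (forall t, `|t| <= 2^-1 -> 0 <= t * (b + t * (c0 + t * c1 + t ^+ 2 * c2))) ->
  b = 0.
Proof.
move=> pos.
pose C := `|c0| + `|c1| + `|c2| + 1.
have Cgt0 : 0 < C by rewrite /C ltr_wpDl // !addr_ge0.
have bound t : `|t| <= 2^-1 -> `|c0 + t * c1 + t ^+ 2 * c2| <= C.
  move=> ht; have t1 : `|t| <= 1 by lra.
  have h1 : `|t * c1| <= `|c1| by rewrite normrM ler_piMl.
  have h2 : `|t ^+ 2 * c2| <= `|c2|.
    by rewrite normrM ler_piMl // normrX exprn_ile1.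
  have := ler_normD (c0 + t * c1) (t ^+ 2 * c2).
  by have := ler_normD c0 (t * c1); rewrite /C; lra.
apply/eqP; case: (boolP (b == 0)) => // b0.
have nb : 0 < `|b| by rewrite normr_gt0.
(* Small enough that [s <= 1/2] and that the remainder, at most [s * C], stays below the absolute
   value of [b]. *)
pose s := `|b| / (2 * (`|b| + C)).
have s0 : 0 < s by rewrite /s divr_gt0 // mulr_gt0 // addr_gt0.
have s2 : s <= 2^-1 by rewrite /s ler_pdivrMr; lra.
have sC : s * C < `|b| by rewrite /s mulrAC ltr_pdivrMr ?ltr_pM2l; lra.
have key t : `|t| = s -> `|t * (c0 + t * c1 + t ^+ 2 * c2)| < `|b|.
  move=> ts; apply: le_lt_trans sC.
  by rewrite normrM ts ler_pM2l // bound // ts.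
have [bgt|blt] : b > 0 \/ b < 0 by case: (ltrgtP b 0) b0 => //; auto.
- have ns : `|- s| = s by rewrite normrN gtr0_norm.
  have /pos : `|- s| <= 2^-1 by rewrite ns.
  rewrite mulNr oppr_ge0 pmulr_rle0 //.
  have := key _ ns; rewrite (gtr0_norm bgt) ltr_norml => /andP[]; lra.
- have ns : `|s| = s by rewrite gtr0_norm.
  have /pos : `|s| <= 2^-1 by rewrite ns.
  rewrite pmulr_rge0 //.
  have := key _ ns; rewrite (ltr0_norm blt) ltr_norml => /andP[]; lra.
Qed.

(** * The stationarity condition on one block *)

Lemma innerE (R : realType) (m n : nat) (X Y : 'M[R]_(m, n)) :
  inner X Y = \sum_i \sum_j X i j * Y i j.
Proof.
rewrite /inner /mxtrace exchange_big; apply: eq_bigr => j _.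
by rewrite mxE; apply: eq_bigr => i _; rewrite mxE.
Qed.

(** The conclusion compares the two off-diagonal entries of [diag_mx d *m A]; it is the first-order
    condition at the identity. *)
Lemma argmin_Junitary2_sym (R : realType) (d : 'rV[R]_2) (k : R)
    (Q : 'M[R]_(2 * 2)) (A : 'M[R]_2) :
  (forall i, d 0 i ^+ 2 = 1) ->
  argmin (Junitary (diag_mx d))
    (fun V => k + 2^-1 * sqnorm_mx Q (V - 1%:M) + inner (V - 1%:M) A) 1%:M ->
  d 0 0 * A 0 1 = d 0 1 * A 1 0.
Proof.
move=> d2 [_ minI].
set a := d 0 0; set b := d 0 1; pose e := a * b.
have a2 : a ^+ 2 = 1 by apply: d2.
have b2 : b ^+ 2 = 1 by apply: d2.
have e2 : e ^+ 2 = 1 by rewrite exprMn a2 b2 mulr1.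
pose mx2 (x y z w : R) : 'M[R]_2 :=
  \matrix_(i, j) if i == 0 then if j == 0 then x else y
                 else if j == 0 then z else w.
(* The velocity of the curve [V] below at t = 0, up to the factor 2. *)
pose W0 := mx2 0 1 (- e) 0.
have [c0 [c1 [c2 qE]]] := sqnorm_mx_affine Q W0 (- e)%:M.
suff : A 0 1 - e * A 1 0 = 0.
  by move/eqP; rewrite subr_eq0 => /eqP->; rewrite /e !mulrA -expr2 a2 mul1r.
pose T := A 0 0 + A 1 1.
(* These coefficients come from multiplying the increase of the model from [I] to [V] by
   [(1 + e * t ^+ 2) ^+ 2 / 2], which clears the denominators, and expanding with [e ^+ 2 = 1]. *)
apply: (@lin_coef_eq0 _ _ (c0 - e * T) (c1 + e * (A 0 1 - e * A 1 0)) (c2 - T)).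
move=> t; rewrite ler_norml => /andP[tl tu].
have t2 : t ^+ 2 <= 4^-1 by nra.
(* The bound on [t] matters for [e = -1], where the denominator is [1 - t ^+ 2]. *)
have D0 : 0 < 1 + e * t ^+ 2.
  by move/eqP: e2; rewrite sqrf_eq1 => /orP[] /eqP ->; nra.
pose r := (1 + e * t ^+ 2)^-1.
have rD : r * (1 + e * t ^+ 2) = 1 by rewrite mulVf // gt_eqF.
pose c := (1 - e * t ^+ 2) * r; pose s := 2 * t * r.
pose V := mx2 c s (- e * s) c.
(* Since [c - 1 = - e * t * s], the factor [s] comes out of every entry. *)
have VE : V - 1%:M = s *: (W0 + t *: (- e)%:M).
  apply/matrixP => i j; rewrite !mxE -!val_eqE /=.
  case: i j => [[|[|//]] ?] [[|[|//]] ?] /=;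
    rewrite ?mulr1n ?mulr0n /c /s.
  - have : r + r * e * t ^+ 2 = 1 by rewrite -rD; lra.
    lra.
  - lra.
  - lra.
  - have : r + r * e * t ^+ 2 = 1 by rewrite -rD; lra.
    lra.
have cs : c ^+ 2 + e * s ^+ 2 = 1.
  have -> : c ^+ 2 + e * s ^+ 2 = (r * (1 + e * t ^+ 2)) ^+ 2.
    by rewrite /c /s; lra.
  by rewrite rD expr1n.
have VJ : Junitary (diag_mx d) V.
  rewrite /Junitary /=; apply/matrixP => i j.
  have ea : b * e = a by rewrite /e mulrCA -expr2 b2 mulr1.
  have eb : a * e = b by rewrite /e mulrA -expr2 a2 mul1r.
  rewrite mul_mx_diag mxE !big_ord_recl big_ord0 !mxE -!val_eqE /= addr0.
  have lift01 : lift ord0 (ord0 : 'I_1) = (1 : 'I_2) by exact/val_inj.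
  rewrite lift01 -/b -[d 0 ord0]/a.
  have ac : a * c ^+ 2 + b * s ^+ 2 = a.
    by rewrite -[in b * _]eb -mulrA -mulrDr cs mulr1.
  have bc : b * c ^+ 2 + a * s ^+ 2 = b.
    by rewrite -[in a * _]ea -mulrA -mulrDr cs mulr1.
  have ebs : e ^+ 2 * (b * s ^+ 2) = b * s ^+ 2 by rewrite e2 mul1r.
  have asc : b * e * (s * c) = a * (s * c) by rewrite ea.
  have d0 h : d 0 (Ordinal (h : (0 < 2)%N)) = a by congr (d 0 _); exact/val_inj.
  have d1 h : d 0 (Ordinal (h : (1 < 2)%N)) = b by congr (d 0 _); exact/val_inj.
  move: i j => [[|[|//]] ?] [[|[|//]] ?] /=;
    rewrite -?val_eqE /= ?mulr1n ?mulr0n ?d0 ?d1; lra.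
(* Writing the zero displacement at the identity as [0 *: 0] lets [sqnorm_mxZ] treat both sides. *)
have := minI V VJ; rewrite subrr VE -(scale0r 0) !sqnorm_mxZ qE.
have lift01 : lift ord0 (ord0 : 'I_1) = (1 : 'I_2) by exact/val_inj.
rewrite !innerE !big_ord_recl !big_ord0 !lift01 !mxE /= ?mulr1n ?mulr0n.
rewrite -[A ord0 ord0]/(A 0 0) -[A ord0 1]/(A 0 1) -[A 1 ord0]/(A 1 0) => min1.
pose q := c0 + t * c1 + t ^+ 2 * c2.
pose g := A 0 1 - e * A 1 0 - e * t * T.
have min2 : 0 <= 2^-1 * s ^+ 2 * q + s * g by rewrite /q /g /T; lra.
have -> : t * (A 0 1 - e * A 1 0 + t * (c0 - e * T +
    t * (c1 + e * (A 0 1 - e * A 1 0)) + t ^+ 2 * (c2 - T))) =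
    t * (t * q + (1 + e * t ^+ 2) * g).
  have eT : e ^+ 2 * (t ^+ 4 * T) = t ^+ 4 * T by rewrite e2 mul1r.
  by move: eT; rewrite /q /g; lra.
have -> : t * (t * q + (1 + e * t ^+ 2) * g) =
    (2^-1 * s ^+ 2 * q + s * g) * ((1 + e * t ^+ 2) ^+ 2 / 2).
  have -> : (2^-1 * s ^+ 2 * q + s * g) * ((1 + e * t ^+ 2) ^+ 2 / 2) =
      t * (t * (r * (1 + e * t ^+ 2)) ^+ 2 * q +
           r * (1 + e * t ^+ 2) * ((1 + e * t ^+ 2) * g)).
    by rewrite /s; lra.
  by rewrite rD; lra.
by rewrite mulr_ge0 // divr_ge0 // sqr_ge0.
Qed.

(** * From symmetric blocks to criticality *)

Lemma sigJ_sq (R : realType) n p : sigJ R n p *m sigJ R n p = 1%:M.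
Proof.
rewrite mulmx_diag; apply/matrixP => i j; rewrite !mxE.
by case: ifP => _; rewrite ?mulrNN mulr1.
Qed.

Lemma tr_sigJ (R : realType) n p : (sigJ R n p)^T = sigJ R n p.
Proof. exact: tr_diag_mx. Qed.

(* [J X G^T X J = G X^T J X J] once [J G X^T] is symmetric, and
   [X^T J X = J]. *)
Lemma critical_of_sym (R : realType) n p (G X : 'M[R]_n) :
  let J := sigJ R n p in
  Junitary J X -> (J *m (G *m X^T))^T = J *m (G *m X^T) ->
  G = J *m X *m G^T *m X *m J.
Proof.
move=> J XJ; rewrite !trmx_mul trmxK tr_sigJ -/J => sym.
have JJ : J *m J = 1%:M by exact: sigJ_sq.
have -> : J *m X *m G^T *m X *m J = J *m (X *m G^T *m J) *m (J *m X *m J).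
  by rewrite !mulmxA -(mulmxA _ J J) JJ mulmx1.
rewrite sym !mulmxA JJ mul1mx -[_ *m X *m J]/(_ *m _ *m J).
have -> : G *m X^T *m J *m X *m J = G *m (X^T *m J *m X) *m J.
  by rewrite !mulmxA.
by rewrite XJ -mulmxA JJ mulmx1.
Qed.

Lemma bs_point_critical (R : realType) n p (f : 'M[R]_n -> R) theta Q X :
  bs_point p f theta Q X -> critical_point p f X.
Proof.
move=> [XJ Xmin]; split=> //; apply/esym/eqP; rewrite subr_eq0; apply/eqP.
apply: critical_of_sym => //; apply/matrixP => i j.
rewrite mxE !mul_diag_mx !mxE.
have [->//|neq] := eqVneq i j.
(* This block contains both entries, [(i, j)] and [(j, i)], that symmetry has to compare. *)
pose B (k : 'I_2) := if k == 0 then i else j.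
have Binj : Omega B.
  move=> [[|[|//]] ?] [[|[|//]] ?] /=; rewrite /B -!val_eqE /= => E;
    by apply/val_inj => //; move: neq; rewrite E eqxx.
have := Xmin B Binj; rewrite /block_model.
have -> : mxsub B B (sigJ R n p) =
    diag_mx (\row_k (if (B k < p)%N then 1 else -1)).
  by apply/matrixP => k l; rewrite !mxE (inj_eq Binj).
move/argmin_Junitary2_sym => sym.
have {}sym := sym _; rewrite !mxE in sym; apply/esym/sym => k.
by rewrite mxE; case: ifP => _; rewrite ?sqrrN expr1n.
Qed.

(** * The counterexample to the converse *)

Lemma differentiable_scale_trace (R : realType) n (a : R) (X : 'M[R]_n) :
  differentiable (fun Y : 'M[R]_n => a * \tr Y) X.
Proof.
rewrite (_ : (fun Y : 'M[R]_n => a * \tr Y) =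
  a *: \sum_(i < n) (fun Y : 'M[R]_n => Y i i : R)).
  apply: differentiableZ; apply: differentiable_sum => i.
  exact: differentiable_coord.
by apply/funext => Y; rewrite fctE fct_sumE.
Qed.

Lemma grad_scale_trace (R : realType) n (a : R) (X : 'M[R]_n) :
  grad (fun Y : 'M[R]_n => a * \tr Y) X = a%:M.
Proof.
set f := fun Y : 'M[R]_n => a * \tr Y.
have f_lin : linear (f : 'M[R]_n -> R^o).
  by move=> c Y Z; rewrite /f linearP /= mulrDr mulrCA.
(* A continuous linear map is its own differential, so the partial derivatives are the values of [f]
   at the matrices [delta_mx i j]. *)
pose fM := GRing.isLinear.Build _ _ _ _ _ f_lin.
pose fL : {linear 'M[R]_n -> R} := HB.pack (f : 'M[R]_n -> R) fM.
apply/matrixP => i j; rewrite mxE deriveE; last exact: differentiable_scale_trace.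
rewrite (@diff_lin _ _ _ fL) => [|Y]; last first.
  exact/differentiable_continuous/differentiable_scale_trace.
rewrite /= /f /mxtrace (bigD1 i) //= big1 => [|l /negPf li].
  by rewrite !mxE eqxx /= addr0 mulr_natr.
by rewrite mxE li.
Qed.

Lemma spectral_norm0 (R : realType) m n : spectral_norm (0 : 'M[R]_(m, n)) = 0.
Proof.
have enorm0 k : enorm (0 : 'cV[R]_k) = 0.
  by rewrite /enorm big1 ?sqrtr0 // => i _; rewrite mxE expr0n.
rewrite /spectral_norm -[RHS](sup1 0); congr sup.
apply/seteqP; split => [_ [x _ <-]|_ ->]; first by rewrite mul0mx enorm0.
by exists 0; rewrite /= ?mul0mx enorm0.
Qed.

Lemma sqnorm_mx0 (R : realType) (m n : nat) (X : 'M[R]_(m, n)) :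
  sqnorm_mx 0 X = 0.
Proof. by rewrite /sqnorm_mx mulmx0 mul0mx mxE. Qed.

(** For the objective [a * \tr X], moving the block from [I] to [- I] changes the model by
    [4 * (theta - a)]; hence a slope above [theta], here [2 * theta]. *)
Lemma critical_not_bs_point (R : realType) (n p N : nat) (theta : R)
    (k : Qmodel) (f := fun (_ : 'I_N) (X : 'M[R]_n) => 2 * theta * \tr X)
    (Q := fun _ : 'I_2 -> 'I_n => 0 : 'M[R]_(2 * 2)) :
  (0 < N)%N -> 0 < theta -> (1 < n)%N ->
  [/\ objective_assumptions f 0 0, Qadmissible k 0 0 1%:M Q,
      critical_point p (objective f) 1%:M
    & ~ bs_point p (objective f) theta Q 1%:M].
Proof.
move=> N0 theta0 n1.
have objE : objective f = fun X => 2 * theta * \tr X.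
  apply/funext => X; rewrite /objective sumr_const card_ord mulrnAr -mulrnAl.
  by rewrite -[_^-1 *+ N]mulr_natr mulVf ?mul1r // pnatr_eq0 -lt0n.
have gradE X : grad (fun X : 'M[R]_n => 2 * theta * \tr X) X = (2 * theta)%:M.
  exact: grad_scale_trace.
have I_Junitary m (J : 'M[R]_m) : Junitary J 1%:M.
  by rewrite /Junitary /= trmx1 mul1mx mulmx1.
split.
- split; first split.
  + by rewrite trmx0.
  + by move=> x; rewrite mulmx0 mul0mx mxE.
  + by rewrite spectral_norm0.
  + move=> i; split=> [X|]; first exact: differentiable_scale_trace.
    rewrite (_ : grad (f i) = cst (2 * theta)%:M); first exact: cst_continuous.
    exact/funext.
  + move=> i X Y; rewrite gradE sqnorm_mx0 mulr0 addr0 /f /inner mul_mx_scalar.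
    by rewrite mxtraceZ mxtrace_tr -mulrDr -linearD /= addrC subrK.
(* With [H = 0] the exact model is zero, and the scalar one is forced to [s = 0] by [Lf = 0]. *)
- move=> B _; have QB : Qlow 0 1%:M B = 0 :> 'M[R]__.
    by rewrite /Qlow mulmx0 mul0mx.
  case: k; first by rewrite QB.
  by exists 0; rewrite QB spectral_norm0 lexx; split=> //; rewrite raddf0.
- split=> //; rewrite objE gradE tr_scalar_mx !mulmx1.
  by rewrite mul_mx_scalar -scalemxAl sigJ_sq scalemx1 subrr.
- move=> [_ min1].
  pose B (l : 'I_2) : 'I_n := widen_ord n1 l.
  have Binj : Omega B by move=> l l' /(congr1 val) /= /val_inj.
  have [_ /(_ (- 1%:M))] := min1 B Binj.
  have VJ : Junitary (mxsub B B (sigJ R n p)) (- 1%:M).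
    rewrite /Junitary /=; have -> : (- 1%:M)^T = - 1%:M :> 'M[R]_2.
      by apply/matrixP => l l'; rewrite !mxE eq_sym.
    by rewrite mulNmx mulmxN mul1mx mulmx1 opprK.
  move=> /(_ VJ); rewrite /block_model add0r !sqnorm_scalar_mx subrr.
  rewrite objE gradE trmx1 mulmx1.
  have -> : mxsub B B (2 * theta)%:M = (2 * theta)%:M :> 'M[R]_2.
    by apply/matrixP => l l'; rewrite !mxE (inj_eq Binj).
  rewrite !innerE !big_ord_recl !big_ord0 !mxE -!val_eqE /=.
  by rewrite mulr1n mulr0n; lra.
Qed.

(** For [n <= 1] there are no blocks, so every feasible point is block stationary and the converse
    holds; its failure is therefore claimed for [1 < n]. *)
Theorem theorem2 (R : realType) (n p N : nat) (theta : R) (k : Qmodel)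
  (hp : (p <= n)%N) (hN : (0 < N)%N) (htheta : 0 < theta) :
  (forall (f : 'I_N -> 'M[R]_n -> R) (H : 'M[R]_(n * n)) (Lf : R)
          (X : 'M[R]_n) (Q : ('I_2 -> 'I_n) -> 'M[R]_(2 * 2)),
     objective_assumptions f H Lf -> Qadmissible k H Lf X Q ->
     bs_point p (objective f) theta Q X -> critical_point p (objective f) X)
  /\
  ((1 < n)%N ->
   ~ (forall (f : 'I_N -> 'M[R]_n -> R) (H : 'M[R]_(n * n)) (Lf : R)
             (X : 'M[R]_n) (Q : ('I_2 -> 'I_n) -> 'M[R]_(2 * 2)),
        objective_assumptions f H Lf -> Qadmissible k H Lf X Q ->
        critical_point p (objective f) X -> bs_point p (objective f) theta Q X)).
Proof.
split=> [f H Lf X Q _ _|n1 all_bs]; first exact: bs_point_critical.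
have [Hf HQ crit nbs] := critical_not_bs_point p k hN htheta n1.
exact/nbs/(all_bs _ _ _ _ _ Hf HQ crit).
Qed.
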